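(* Let $n\ge 1$ and $0\le k\le n$ be integers. Let $\mathcal{B}(n,k)$ be the set of all barrier tilings of a $1\times n$ strip with barrier point $k$, and let $B(T)$ be the weight of a barrier tiling $T$. Then $$[F_{n+1}]_q=\sum_{T\in\mathcal{B}(n,k)}B(T).$$
   Context: Fibonacci numbers: $F_0=0$, $F_1=1$, $F_n=F_{n-1}+F_{n-2}$. For an integer $m\ge 0$, $[m]_q=\sum_{i=0}^{m-1}q^i$ (so $[0]_q=0$), with $q$ an indeterminate. Barrier tilings. Consider a $1\times n$ strip with cells numbered $1,\dots,n$ from left to right. The barrier point $k$ is the point on the bottom of the strip located after exactly $k$ cells from the left end. A barrier is of one of two types. An $I$ barrier moves one unit vertically up from the barrier point, so it splits the strip into a left compartment consisting of cells $1,\dots,k$ and a right compartment consisting of cells $k+1,\dots,n$. An $L$ barrier moves first one unit to the left and then one unit vertically up, so it splits the strip into a left compartment consisting of cells $1,\dots,k-1$ and a right compartment consisting of cells $k,\dots,n$ (it requires $k\ge 1$). A barrier tiling with barrier point $k$ consists of a choice of barrier ($I$ or $L$) together with a tiling of each of the two compartments, independently, by monominos (covering one cell) and dominos (covering two adjacent cells of the same compartment), subject to the constraint that, if the barrier is of type $L$, the first (leftmost) tile of the right compartment must be a domino, i.e. a domino covering cells $k$ and $k+1$; this domino is called the special domino. In particular an $L$ barrier can occur only when $1\le k\le n-1$. Compartments may be empty, in which case they have exactly one (empty) tiling. Weights. The height of an $I$ barrier is one plus the number of cells in the right compartment, that is, $n-k+1$. The height of an $L$ barrier is one plus the number of cells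 in the left compartment, that is, $k$. The height $h(d)$ of a domino $d$ is the height of the barrier of the tiling. The floor $f(d)$ of a domino $d$ is the number of cells between the end of the strip lying in the same compartment as $d$ and the farthest end of $d$ from that end of the strip: if $d$ covers cells $i-1,i$ and lies in the left compartment, then $f(d)=i$; if $d$ covers cells $i,i+1$ and lies in the right compartment, then $f(d)=n-i+1$. Each monomino has weight $1$. A domino $d$ in the right compartment of an $I$ barrier or in the left compartment of an $L$ barrier has weight $q^{F_{f(d)}}$. A domino $d$ in the left compartment of an $I$ barrier, or a non-special domino $d$ in the right compartment of an $L$ barrier, has weight $q^{F_{f(d)}F_{h(d)}}$. The special domino $d$ has weight $q^{F_{f(d)}F_{h(d)+1}}$. The weight $B(T)$ of a barrier tiling $T$ is the product of the weights of all its tiles. *)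

(* Defs.v *)
From HB Require Import structures.
From mathcomp Require Import all_boot all_order all_algebra.

Set Implicit Arguments.
Unset Strict Implicit.
Unset Printing Implicit Defensive.

Import GRing.Theory.
Local Open Scope ring_scope.

Fixpoint fib (n : nat) : nat :=
  match n with
  | 0 => 0
  | 1 => 1
  | (m.+1 as p).+1 => (fib p + fib m)%N
  end.

(* The indeterminate q is 'X in {poly int}. *)
Definition qint (m : nat) : {poly int} := \sum_(i < m) 'X^i.

(* The strip is 'I_n; cells are numbered from 1, whereas ordinals start at 0. *)
Definition pos (n : nat) (c : 'I_n) : nat := c.+1.

(* A tile is identified with the set of cells that it covers. *)
Definition is_monomino (n : nat) (d : {set 'I_n}) : bool :=
  [exists c, d == [set c]].

Definition is_domino (n : nat) (d : {set 'I_n}) : bool :=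
  [exists c, exists c', (pos c' == (pos c).+1) && (d == [set c; c'])].

(* If A is empty then P = set0 is its unique tiling. *)
Definition is_tiling (n : nat) (P : {set {set 'I_n}}) (A : {set 'I_n}) : bool :=
  partition P A && [forall d in P, is_monomino d || is_domino d].

Inductive barrier := BarrierI | BarrierL.

Definition bool_of_barrier (b : barrier) : bool :=
  if b is BarrierI then true else false.
Definition barrier_of_bool (b : bool) : barrier :=
  if b then BarrierI else BarrierL.
Lemma bool_of_barrierK : cancel bool_of_barrier barrier_of_bool.
Proof. by case. Qed.
HB.instance Definition _ := Finite.copy barrier (can_type bool_of_barrierK).

Definition left_compartment (n k : nat) (b : barrier) : {set 'I_n} :=
  match b with
  | BarrierI => [set c | (pos c <= k)%N]
  | BarrierL => [set c | (pos c < k)%N]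
  end.

Definition right_compartment (n k : nat) (b : barrier) : {set 'I_n} :=
  match b with
  | BarrierI => [set c | (k < pos c)%N]
  | BarrierL => [set c | (k <= pos c)%N]
  end.

(* The cells k and k+1; this is a domino exactly when 1 <= k <= n - 1. *)
Definition special_domino (n k : nat) : {set 'I_n} :=
  [set c | (pos c == k) || (pos c == k.+1)].

(* (b, L, R): barrier type, tiling of the left compartment, tiling of the
   right compartment. *)
Notation barrier_tiling n :=
  (barrier * {set {set 'I_n}} * {set {set 'I_n}})%type (only parsing).

Definition barrier_tilings (n k : nat) :
    {set barrier_tiling n} :=
  [set T | let: (b, L, R) := T in
    [&& is_tiling L (left_compartment n k b),
        is_tiling R (right_compartment n k b) &
        (b == BarrierL) ==>
          [&& (0 < k)%N, is_domino (special_domino n k)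
            & special_domino n k \in R]]].

Definition height (n k : nat) (b : barrier) : nat :=
  match b with
  | BarrierI => #|right_compartment n k BarrierI|.+1
  | BarrierL => #|left_compartment n k BarrierL|.+1
  end.

(* In the left (resp. right) compartment, the cell at position i is at distance
   i (resp. n - i + 1) from the end of the strip, counting the cell itself; the
   maximum is attained at the cell of d farthest from that end. *)
Definition left_floor (n : nat) (d : {set 'I_n}) : nat :=
  (\max_(c in d) pos c)%N.
Definition right_floor (n : nat) (d : {set 'I_n}) : nat :=
  (\max_(c in d) (n - pos c).+1)%N.

Definition left_weight (n k : nat) (b : barrier) (d : {set 'I_n}) : {poly int} :=
  if is_domino d then
    match b with
    | BarrierI => 'X^(fib (left_floor d) * fib (height n k b))
    | BarrierL => 'X^(fib (left_floor d))
    end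
  else 1.

Definition right_weight (n k : nat) (b : barrier) (d : {set 'I_n}) : {poly int} :=
  if is_domino d then
    match b with
    | BarrierI => 'X^(fib (right_floor d))
    | BarrierL =>
        if d == special_domino n k
        then 'X^(fib (right_floor d) * fib ((height n k b).+1))
        else 'X^(fib (right_floor d) * fib (height n k b))
    end
  else 1.

Definition barrier_weight (n k : nat)
    (T : barrier_tiling n) : {poly int} :=
  let: (b, L, R) := T in
  (\prod_(d in L) left_weight k b d) * (\prod_(d in R) right_weight k b d).

(* Main.v *)
(* Removing the tile farthest from the end of a compartment of m cells gives,
   when dominos weigh q^(a F_f), the recurrence
   [F_(m+1)]_(q^a) = [F_m]_(q^a) + q^(a F_m) [F_(m-1)]_(q^a).
   Since [x]_q [y]_(q^x) = [x y]_q, the I tilings add up to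
   [F_(k+1) F_(n-k+1)]_q and the L tilings to
   q^(F_(k+1) F_(n-k+1)) [F_k F_(n-k)]_q.  The total is [F_(n+1)]_q because
   F_(n+1) = F_(k+1) F_(n-k+1) + F_k F_(n-k). *)

Require Import Defs.
From mathcomp Require Import all_boot all_order all_algebra.
From mathcomp Require Import zify.

Import GRing.Theory.
Local Open Scope ring_scope.

(** * Fibonacci numbers and q-integers *)

Lemma fibSS n : fib n.+2 = (fib n.+1 + fib n)%N.
Proof. by []. Qed.

Lemma fib_addS m k :
  fib (m + k).+1 = (fib m.+1 * fib k.+1 + fib m * fib k)%N.
Proof.
elim: m k => [|m IHm] k; first by rewrite mul1n mul0n addn0.
by rewrite addSnnS IHm !fibSS; lia.
Qed.

(* [m]_(q^a) *)
Definition qint_pow (a m : nat) : {poly int} := \sum_(i < m) 'X^(a * i).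

Lemma qint_pow1 m : qint_pow 1 m = qint m.
Proof. by apply: eq_bigr => i _; rewrite mul1n. Qed.

Lemma qint_powD a m k :
  qint_pow a (m + k) = qint_pow a m + 'X^(a * m) * qint_pow a k.
Proof.
rewrite /qint_pow big_split_ord mulr_sumr; congr (_ + _).
by apply: eq_bigr => i _; rewrite -exprD -mulnDr.
Qed.

Lemma qintD m k : qint (m + k) = qint m + 'X^m * qint k.
Proof. by rewrite -!qint_pow1 qint_powD mul1n. Qed.

(** The [m * k] consecutive powers of q fall into [k] blocks of length [m]; the induction splits off
    the last block, ['X^(m * k)] times [qint m]. *)
Lemma qint_mul m k : qint m * qint_pow m k = qint (m * k).
Proof.
elim: k => [|k IHk]; first by rewrite /qint_pow /qint muln0 !big_ord0 mulr0.
by rewrite -addn1 qint_powD mulrDr IHk mulnDr muln1 qintD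
  /qint_pow big_ord1 muln0 mulr1 mulrC.
Qed.

(** * Weighted tilings of a set of cells *)

Section Tilings.

Variables (n : nat) (w : {set 'I_n} -> {poly int}).
Implicit Types (A B : {set 'I_n}) (P : {set {set 'I_n}}).

Definition is_tile B : bool := is_monomino B || is_domino B.

(** [A] is any set of cells, so that what remains after removing a tile is again of this form. *)
Definition tiling_sum A : {poly int} :=
  \sum_(P | is_tiling P A) \prod_(d in P) w d.

Lemma tiling_sum0 : tiling_sum set0 = 1.
Proof.
rewrite /tiling_sum (big_pred1 set0) ?big_set0 // => P.
rewrite /is_tiling partition_set0 /=; case: eqP => //= ->.
by apply/forall_inP => d; rewrite inE.
Qed.

Lemma tile_neq0 B : is_tile B -> B != set0.
Proof.
case/orP; first by case/existsP => c /eqP->; apply/set0Pn; exists c; rewrite set11.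
case/existsP => c /existsP[c' /andP[_ /eqP->]].
by apply/set0Pn; exists c; rewrite set21.
Qed.

(** Deleting [B] is a bijection onto the tilings of [A :\: B], with inverse [B |: P]. As [B] is
    nonempty, it cannot already be a tile of [A :\: B]. *)
Lemma tiling_sum_mem A B : is_tile B -> B \subset A ->
  \sum_(P | is_tiling P A && (B \in P)) \prod_(d in P) w d =
    w B * tiling_sum (A :\: B).
Proof.
move=> tB sBA.
have B0 := tile_neq0 _ tB.
have notin P : is_tiling P (A :\: B) -> B \notin P.
  case/andP=> partP _; apply/negP => BP.
  have: B \subset A :\: B by rewrite -(cover_partition partP); apply: bigcup_sup.
  rewrite subsetD => /andP[_]; rewrite -setI_eq0 setIid.
  by rewrite (negbTE B0).
rewrite (reindex_onto (fun P => B |: P) (fun P => P :\ B)); last first.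
  by move=> P /andP[_ BP]; rewrite setD1K.
rewrite mulr_sumr; apply: eq_big => [P|P].
  rewrite setU11 andbT; apply/andP/idP => [[/andP[partP /forall_inP tP] /eqP e]|tP].
    apply/andP; split; first by rewrite -e partitionD1 // setU11.
    by apply/forall_inP => d dP; apply: tP; rewrite inE dP orbT.
  split; last by rewrite setU1K // notin.
  case/andP: tP => partP /forall_inP tP; apply/andP; split.
    rewrite -(setID A B) (setIidPr sBA); apply: partitionU1 => //.
    by rewrite disjoint_sym disjoints_subset setDE subsetIr.
  by apply/forall_inP => d; rewrite !inE => /orP[/eqP->|/tP].
by case/andP=> _ /eqP <-; rewrite big_setU1 ?setD11.
Qed.

(** Tilings are sorted by [pblock P x], the unique tile that covers [x]. *)
Lemma tiling_sum_block A x : x \in A ->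
  tiling_sum A =
    \sum_(B | [&& is_tile B, x \in B & B \subset A]) w B * tiling_sum (A :\: B).
Proof.
move=> xA; rewrite {1}/tiling_sum.
rewrite (partition_big (fun P => pblock P x)
  (fun B => [&& is_tile B, x \in B & B \subset A])) /=; last first.
  move=> P /andP[partP /forall_inP tP].
  have xP : x \in cover P by rewrite (cover_partition partP).
  have bP := pblock_mem xP.
  rewrite /is_tile tP //= mem_pblock xP andTb -(cover_partition partP).
  exact: (bigcup_sup (pblock P x)).
apply: eq_bigr => B /and3P[tB xB sBA]; rewrite -tiling_sum_mem //.
apply: eq_bigl => P; apply: andb_id2l => /andP[partP _].
apply/eqP/idP => [<-|BP]; last by apply: def_pblock => //; case/and3P: partP.
by rewrite pblock_mem // (cover_partition partP).
Qed.

(* [p] numbers the cells from either end of the strip, so that both kinds of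
   compartments are covered. *)
Variable p : 'I_n -> nat.
Hypotheses (p_inj : injective p) (p_gt0 : forall c, (0 < p c)%N).
Hypothesis p_onto : forall m, (0 < m <= n)%N -> exists c, p c = m.
Hypothesis p_domino : forall B, is_domino B =
  [exists c, exists c', (p c' == (p c).+1) && (B == [set c; c'])].

Variable a : nat.

(** Sorting by the tile on the farthest cell gives the recurrence of the q-integers. The weight
    formula is assumed only for tiles inside the segment, which leaves room for the exceptional
    weight of the special domino. *)
Lemma tiling_sum_segment m : (m <= n)%N ->
  (forall B, is_tile B -> {in B, forall c, (p c <= m)%N} ->
    w B = if is_domino B then 'X^(a * fib (\max_(c in B) p c)) else 1) ->
  tiling_sum [set c | (p c <= m)%N] = qint_pow a (fib m.+1).
Proof.
have dominoP (B : {set 'I_n}) :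
    reflect (exists c c', p c' = (p c).+1 /\ B = [set c; c']) (is_domino B).
  rewrite p_domino; apply: (iffP existsP) => -[c].
    by case/existsP=> c' /andP[/eqP ? /eqP ?]; exists c, c'.
  by case=> c' [pc eB]; exists c; apply/existsP; exists c'; rewrite pc eB !eqxx.
have mono_tile x : is_tile [set x].
  by apply/orP; left; apply/existsP; exists x.
have mono_dom (x : 'I_n) : is_domino [set x] = false.
  apply/dominoP => -[c [c' [pc /setP e]]].
  have: c \in [set x] by rewrite e set21.
  have: c' \in [set x] by rewrite e set22.
  by move=> /set1P c'x /set1P cx; move: pc; rewrite c'x cx; lia.
elim/ltn_ind: m => -[_ _ _|m IHm mn wE].
  rewrite (_ : [set c | _] = set0); last first.
    by apply/setP => c; rewrite !inE leqNgt p_gt0.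
  by rewrite tiling_sum0 /qint_pow big_ord1 muln0.
have {}IHm m' : (m' <= m)%N ->
    tiling_sum [set c | (p c <= m')%N] = qint_pow a (fib m'.+1).
  move=> lem; apply: IHm => [||B tB Bm]; [by []|lia|].
  by apply: wE => // c /Bm; lia.
have [x px] : exists c, p c = m.+1 by apply: p_onto.
rewrite (tiling_sum_block _ x) ?inE ?px // (bigD1 [set x]); last first.
  by rewrite mono_tile set11 sub1set inE px leqnn.
rewrite wE ?mono_tile ?mono_dom //; last by move=> c /set1P->; rewrite px.
rewrite mul1r (_ : _ :\: [set x] = [set c | (p c <= m)%N]); last first.
  apply/setP => c; rewrite !inE -(inj_eq p_inj) px; lia.
rewrite IHm //.
(* The far cell [x] can only be the upper cell of a domino, since the cell after it would leave the
   segment. *)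
have tile_x B : [&& is_tile B, x \in B & B \subset [set c | (p c <= m.+1)%N]] &&
    (B != [set x]) -> exists2 y, p y = m & B = [set y; x].
  case/andP=> /and3P[tB xB sB] nB.
  have /dominoP[c [c' [pc eB]]] : is_domino B.
    case/orP: tB => // /existsP[c /eqP eB].
    by move: xB nB; rewrite eB => /set1P->; rewrite eqxx.
  have : c' \in [set c | (p c <= m.+1)%N] by apply: (subsetP sB); rewrite eB set22.
  rewrite inE => pc'.
  have xc' : x = c'.
    by move: xB; rewrite eB => /set2P[] // xc; rewrite -xc px in pc; lia.
  by exists c; [move: pc; rewrite -xc' px => -[] | rewrite xc'].
(* In a segment of one cell only the monomino fits, which agrees with F_2 = F_1. *)
case: m mn wE IHm px tile_x => [|m] mn wE IHm px tile_x.
  rewrite big1 => [|B /tile_x[y py _]]; first exact: addr0.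
  by have := p_gt0 y; rewrite py.
have [y py] : exists c, p c = m.+1 by apply: p_onto; lia.
have dyx : is_domino [set y; x] by apply/dominoP; exists y, x; rewrite py px.
have yx : y != x by rewrite -(inj_eq p_inj) py px; lia.
rewrite (big_pred1 [set y; x]) => [|B]; last first.
  apply/idP/eqP => [/tile_x[z pz ->]|->].
    by rewrite (p_inj z y) // pz py.
  rewrite /is_tile dyx orbT set22 subUset !sub1set !inE px py leqnn leqnSn /=.
  by apply/eqP => /setP/(_ y); rewrite !inE eqxx (negbTE yx).
have tyx : is_tile [set y; x] by rewrite /is_tile dyx orbT.
rewrite (wE _ tyx) ?dyx; last by move=> c /set2P[]->; rewrite ?px ?py; lia.
rewrite (_ : _ :\: [set y; x] = [set c | (p c <= m)%N]); last first.
  apply/setP => c; rewrite !inE -!(inj_eq p_inj) px py; lia.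
(* The domino has floor [m.+2], so its weight is exactly the shift between the two parts of
   [fib m.+3 = fib m.+2 + fib m.+1]. *)
rewrite IHm // (fibSS m.+1) qint_powD -[LHS]/(_ + _).
rewrite big_setU1 ?inE //= big_set1 px py.
by rewrite maxnE subSnn addn1.
Qed.

End Tilings.

Arguments is_tile {n} B.
Arguments tiling_sum {n} w A.

(** * The two compartments and their contributions *)

Section Strip.

Variable n : nat.

Lemma left_segment_sum (w : {set 'I_n} -> {poly int}) a m : (m <= n)%N ->
  (forall B, is_tile B -> {in B, forall c, (pos c <= m)%N} ->
    w B = if is_domino B then 'X^(a * fib (left_floor B)) else 1) ->
  tiling_sum w [set c | (pos c <= m)%N] = qint_pow a (fib m.+1).
Proof.
apply: tiling_sum_segment => //.
- by move=> c c' [/val_inj].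
- by case=> // m' /andP[_ m'n]; exists (Ordinal m'n).
Qed.

Lemma right_segment_sum (w : {set 'I_n} -> {poly int}) a m : (m <= n)%N ->
  (forall B, is_tile B -> {in B, forall c : 'I_n, (n - c <= m)%N} ->
    w B = if is_domino B then 'X^(a * fib (right_floor B)) else 1) ->
  tiling_sum w [set c : 'I_n | (n - c <= m)%N] = qint_pow a (fib m.+1).
Proof.
move=> mn wE.
(* Ordinals start at 0, so [n - c] is the position counted from 1 at the right end. *)
apply: (tiling_sum_segment _ _ (fun c : 'I_n => n - c)%N) => //.
- move=> c c' /= e; apply: val_inj => /=.
  by have := ltn_ord c; have := ltn_ord c'; lia.
- by move=> c; rewrite subn_gt0.
- move=> m' m'n; have lt : (n - m' < n)%N by lia.
  by exists (Ordinal lt) => /=; lia.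
(* Reversing the numbering exchanges the two cells of a domino. *)
- move=> B; apply/existsP/existsP => -[c /existsP[c' /andP[e /eqP->]]];
    exists c'; apply/existsP; exists c; rewrite setUC eqxx andbT;
    have := ltn_ord c; have := ltn_ord c'; move: e; rewrite /pos; lia.
- move=> B tB Bm; rewrite wE //; case: ifP => // _.
  rewrite /right_floor; congr 'X^(a * fib _).
  by apply: eq_bigr => c _; rewrite /pos; have := ltn_ord c; lia.
Qed.

Lemma card_ord_lt m : (m <= n)%N -> #|[set c : 'I_n | (c < m)%N]| = m.
Proof.
by move=> mn; rewrite -sum1dep_card (big_ord_narrow mn) sum1_card card_ord.
Qed.

Variables (k : nat) (hk : (k <= n)%N).

Lemma heightI : height n k BarrierI = (n - k).+1.
Proof.
congr _.+1; rewrite -[X in (X - _)%N](card_ord n) -(cardsC [set c : 'I_n | (c < k)%N]).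
rewrite card_ord_lt // addKn; apply: eq_card => c; rewrite !inE /pos; lia.
Qed.

Lemma heightL : (0 < k)%N -> height n k BarrierL = k.
Proof.
move=> k0; rewrite -[RHS](prednK k0); congr _.+1.
rewrite -[RHS]card_ord_lt; last by lia.
by apply: eq_card => c; rewrite !inE /pos; lia.
Qed.

Lemma is_domino_special :
  (0 < k)%N && is_domino (special_domino n k) = (0 < k < n)%N.
Proof.
apply: andb_id2l => k0; apply/existsP/idP => [[c /existsP[c' /andP[pc /eqP/setP e]]]|kn].
  have := e c; have := e c'; rewrite !inE !eqxx orbT /=.
  by have := ltn_ord c; have := ltn_ord c'; move: pc; rewrite /pos; lia.
have lt1 : (k.-1 < n)%N by lia.
exists (Ordinal lt1); apply/existsP; exists (Ordinal kn).
rewrite /pos /= prednK // eqxx; apply/eqP/setP => c.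
by rewrite !inE -!val_eqE /= /pos; lia.
Qed.

Lemma sum_barrier (F : barrier -> {poly int}) :
  \sum_b F b = F BarrierI + F BarrierL.
Proof.
rewrite (bigD1 BarrierI) //= (bigD1 BarrierL) //= big1 ?addr0 //.
by case.
Qed.

(** The right compartment gives [[F_(n-k+1)]_q], and the left one [[F_(k+1)]] in the base
    [q^(F_(n-k+1))], so [qint_mul] applies. *)
Lemma barrier_sumI :
  tiling_sum (left_weight k BarrierI) (left_compartment n k BarrierI) *
  tiling_sum (right_weight k BarrierI) (right_compartment n k BarrierI) =
    qint (fib k.+1 * fib (n - k).+1).
Proof.
rewrite (left_segment_sum _ (fib (n - k).+1)) //; last first.
  by move=> B _ _; rewrite /left_weight heightI mulnC.
rewrite (_ : right_compartment n k _ = [set c : 'I_n | (n - c <= n - k)%N]); last first.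
  by apply/setP => c; rewrite !inE /pos; have := ltn_ord c; lia.
rewrite (right_segment_sum _ 1); [|by lia|].
  by rewrite qint_pow1 mulrC qint_mul mulnC.
by move=> B _ _; rewrite /right_weight mul1n.
Qed.

(** Once the special domino is removed, the [k - 1] cells on the left give [[F_k]_q] and the
    [n - k - 1] cells on the right give [[F_(n-k)]] in the base [q^(F_k)]. The special domino
    supplies the power of q in front. *)
Lemma barrier_sumL : (0 < k < n)%N ->
  tiling_sum (left_weight k BarrierL) (left_compartment n k BarrierL) *
  (right_weight k BarrierL (special_domino n k) *
   tiling_sum (right_weight k BarrierL)
     (right_compartment n k BarrierL :\: special_domino n k)) =
    'X^(fib k.+1 * fib (n - k).+1) * qint (fib k * fib (n - k)).
Proof.
move=> k0n; have /andP[k0 dS] : (0 < k)%N && is_domino (special_domino n k).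
  by rewrite is_domino_special.
have kn : (k < n)%N by case/andP: k0n.
rewrite (_ : left_compartment n k _ = [set c | (pos c <= k.-1)%N]); last first.
  by apply/setP => c; rewrite !inE; lia.
rewrite (left_segment_sum _ 1); [|by lia|]; last first.
  by move=> B _ _; rewrite /left_weight mul1n.
rewrite (_ : _ :\: _ = [set c : 'I_n | (n - c <= (n - k).-1)%N]); last first.
  by apply/setP => c; rewrite !inE /pos; have := ltn_ord c; lia.
rewrite (right_segment_sum _ (fib k)); [|by lia|]; last first.
  (* The special domino contains cell [k + 1], the ordinal [k], which lies outside the remaining
     segment. *)
  move=> B _ Bm; have BS : B == special_domino n k = false.
    apply/eqP => eB; have := Bm (Ordinal kn).
    by rewrite eB inE /pos /= eqxx orbT => /(_ isT); lia.
  by rewrite /right_weight BS heightL // mulnC.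
rewrite qint_pow1 !prednK //; last by lia.
rewrite mulrCA qint_mul /right_weight dS eqxx heightL // mulnC.
(* The floor of the special domino is [n - k + 1], attained at cell [k], the ordinal [k - 1]. *)
congr ('X^(_ * fib _) * _); apply/eqP; rewrite eqn_leq; apply/andP; split.
  by apply/bigmax_leqP => c; rewrite inE /pos; lia.
have lt1 : (k.-1 < n)%N by lia.
apply: leq_trans (leq_bigmax_cond (Ordinal lt1) _); first by rewrite /pos /=; lia.
by rewrite inE /pos /= prednK // eqxx.
Qed.

End Strip.

Theorem theorem2p3 (n k : nat) (hn : (1 <= n)%N) (hk : (k <= n)%N) :
  qint (fib n.+1) = \sum_(T in barrier_tilings n k) barrier_weight k T.
Proof.
pose okL (b : barrier) (R : {set {set 'I_n}}) := (b == BarrierL) ==>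
  [&& (0 < k)%N, is_domino (special_domino n k) & special_domino n k \in R].
(* The condition on L barriers involves only the right tiling, so for each barrier the sum over left
   tilings factors out. *)
have -> : \sum_(T in barrier_tilings n k) barrier_weight k T =
    \sum_b tiling_sum (left_weight k b) (left_compartment n k b) *
      \sum_(R | is_tiling R (right_compartment n k b) && okL b R)
        \prod_(d in R) right_weight k b d.
  under [RHS]eq_bigr => b _ do rewrite big_distrlr pair_big.
  rewrite pair_big_dep [RHS](reindex (fun T => (T.1.1, (T.1.2, T.2)))) /=.
    by apply: eq_big => -[[b L] R] //; rewrite inE.
  by exists (fun T => (T.1, T.2.1, T.2.2)) => [[[? ?] ?]|[? [? ?]]].
rewrite sum_barrier.
under eq_bigl do rewrite /okL andbT.
rewrite barrier_sumI // -{1}(subnKC hk) fib_addS qintD; congr (_ + _).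
under eq_bigl do rewrite /okL eqxx andbA is_domino_special //.
case: (boolP (0 < k < n)%N) => [kn|kn].
  have /andP[k0 dS] : (0 < k)%N && is_domino (special_domino n k).
    by rewrite is_domino_special.
  rewrite /= tiling_sum_mem; first by rewrite barrier_sumL.
    by rewrite /is_tile dS orbT.
  by apply/subsetP => c; rewrite !inE; lia.
(* For [k = 0] or [k = n] there is no L tiling, and the second summand vanishes because F_0 = 0. *)
rewrite big_pred0 => [|R]; last by rewrite andbF.
have -> : (fib k * fib (n - k) = 0)%N.
  have [->|->] : k = 0%N \/ k = n by lia.
    by [].
  by rewrite subnn muln0.
by rewrite /qint big_ord0 !mulr0.
Qed.
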